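(* Let $G$ be a connected graph of order $n$. If the spectrum of $G$ contains $\{0,(\pm1)^{(n-3)/2}\}$ (that is, $0$ is an eigenvalue and each of $1$ and $-1$ occurs with multiplicity at least $(n-3)/2$), then $G$ is (isomorphic to) one of the graphs $\mathcal{S}_n$, $\mathcal{R}_n$, $\mathcal{Q}_n$, $\mathcal{H}_{\frac{n-1}{2},\frac{n+1}{2}}$, $G_3$, or $G_4$.
   Context: Graphs are finite, simple and undirected; the spectrum of a graph is the multiset of eigenvalues of its adjacency matrix, and exponents denote multiplicities. Here $n\ge 3$ is odd. A matrix $N$ is the bipartite adjacency matrix of a bipartite graph $G$ if the adjacency matrix of $G$ can be arranged as $\begin{pmatrix}O&N\\N^\top&O\end{pmatrix}$ with square zero blocks. $J$ denotes an all-ones matrix of appropriate size ($J_{r,\ell}$ if $r\times\ell$, $J_r$ if $r\times r$), $I_\ell$ the identity, and $\widetilde{I_\ell}=(I_\ell\ \ \mathbf 1_\ell)$ the $\ell\times(\ell+1)$ matrix obtained by appending an all-ones column to $I_\ell$. $\mathcal{S}_{2k+1}$ is the subdivision of the star $K_{1,k}$ (a new vertex is inserted on every edge). $\mathcal{L}_{k,k}$ is $K_{k,k}$ minus a perfect matching. $\mathcal{H}_{k,k+1}$ is obtained from $\mathcal{L}_{k,k}$ by adding a new vertex joined to all vertices of one part. For $n=2k+1$ with $k\ge3$, $\mathcal{R}_n$ and $\mathcal{Q}_n$ are the bipartite graphs with $k\times(k+1)$ bipartite adjacency matrices $$\begin{pmatrix}I_{k-3}&J\\O&\widetilde{I_3}\end{pmatrix},\qquad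 \begin{pmatrix}\widetilde{I_{k-3}}&J\\O&J_3-I_3\end{pmatrix},$$ respectively. $G_3$ and $G_4$ are the bipartite graphs of order $11$ with $5\times 6$ bipartite adjacency matrices $$\begin{pmatrix}J_4-I_4&J_{4,2}\\O&J_{1,2}\end{pmatrix},\qquad\begin{pmatrix}J_3-I_3&J_{3,3}\\O&\widetilde{I_2}\end{pmatrix},$$ respectively. *)

(* Defs.v *)
From HB Require Import structures.
From mathcomp Require Import all_boot all_order all_algebra all_field.

Set Implicit Arguments.
Unset Strict Implicit.
Unset Printing Implicit Defensive.

Import Order.TTheory GRing.Theory Num.Theory.
Local Open Scope ring_scope.

Record sgraph := SGraph {
  svertex :> finType;
  sedge : rel svertex;
  sedge_sym : symmetric sedge;
  sedge_irr : irreflexive sedge }.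

Arguments sedge {s}.

Definition connected (G : sgraph) : Prop :=
  forall x y : G, connect sedge x y.

Definition isomorphic (G H : sgraph) : Prop :=
  exists2 f : G -> H, bijective f & forall x y, sedge (f x) (f y) = sedge x y.

Definition adjmx (G : sgraph) : 'M[algC]_#|G| :=
  \matrix_(i, j) (sedge (enum_val i) (enum_val j))%:R.

(* The eigenvalues with algebraic multiplicity. The characteristic polynomial
   has integer coefficients, so all its complex roots lie in algC. *)
Definition spectrum (G : sgraph) : seq algC :=
  sval (closed_field_poly_normal (char_poly (adjmx G))).

Lemma spectrumP (G : sgraph) :
  char_poly (adjmx G) = \prod_(z <- spectrum G) ('X - z%:P).
Proof.
rewrite /spectrum; case: closed_field_poly_normal => s /= {1}->.
by rewrite (monicP (char_poly_monic _)) scale1r.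
Qed.

(* Inclusion counting repetitions. *)
Definition msubset (T : eqType) (s t : seq T) : Prop :=
  forall x, (count_mem x s <= count_mem x t)%N.

Section Bipartite.
Variables (X Y : finType) (r : X -> Y -> bool).

Definition bip_rel (u v : X + Y) : bool :=
  match u, v with
  | inl x, inr y | inr y, inl x => r x y
  | _, _ => false
  end.

Lemma bip_rel_sym : symmetric bip_rel.
Proof. by case=> ? [?|?]. Qed.

Lemma bip_rel_irr : irreflexive bip_rel.
Proof. by case. Qed.

Definition bipartite_graph : sgraph := SGraph bip_rel_sym bip_rel_irr.

End Bipartite.

Definition bip_adjmx (r c : nat) (N : 'M[algC]_(r, c)) (G : sgraph) : Prop :=
  exists2 f : 'I_(r + c) -> G, bijective f &
    \matrix_(i, j) (sedge (f i) (f j))%:R = block_mx 0 N N^T 0.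

(* Only meaningful for 0-1 matrices; see bip_graphP. *)
Definition bip_graph (r c : nat) (N : 'M[algC]_(r, c)) : sgraph :=
  bipartite_graph (fun i j => N i j == 1).

Lemma bip_graphP (r c : nat) (N : 'M[algC]_(r, c)) :
  (forall i j, (N i j == 0) || (N i j == 1)) -> bip_adjmx N (bip_graph N).
Proof.
move=> N01.
have N01E i j : (N i j == 1)%:R = N i j.
  by case/orP: (N01 i j) => /eqP ->; rewrite ?eqxx // [0 == 1]eq_sym oner_eq0.
exists (@split r c : 'I_(r + c) -> bip_graph N); first by exact: Bijective (@splitK r c) (@unsplitK r c).
apply/matrixP=> i j; rewrite !mxE /=.
by case: (split i) => i'; rewrite !mxE; case: (split j) => j' /=;
  rewrite ?mxE ?N01E.
Qed.

Lemma bip_adjmx_iso (r c : nat) (N : 'M[algC]_(r, c)) (G H : sgraph) :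
  bip_adjmx N G -> bip_adjmx N H -> isomorphic G H.
Proof.
move=> [f [f' fK f'K] /matrixP fE] [g g_bij /matrixP gE].
exists (g \o f'); first by apply: bij_comp => //; exists f.
move=> x y /=; have := gE (f' x) (f' y); rewrite -fE !mxE !f'K => /eqP.
by rewrite eqr_nat; case: (sedge _ _); case: (sedge _ _).
Qed.

Definition edges (G : sgraph) : {set {set G}} :=
  [set [set p.1; p.2] | p : G * G & sedge p.1 p.2].

Definition subdivision (G : sgraph) : sgraph :=
  @bipartite_graph G {A : {set G} | A \in edges G} (fun x A => x \in val A).

Section AddVertex.
Variables (G : sgraph) (A : {set G}).

Definition add_rel (u v : option G) : bool :=
  match u, v with
  | Some x, Some y => sedge x y
  | Some x, None | None, Some x => x \in A
  | None, None => false
  end.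

Lemma add_rel_sym : symmetric add_rel.
Proof. by case=> [x|] [y|] //=; exact: sedge_sym. Qed.

Lemma add_rel_irr : irreflexive add_rel.
Proof. by case=> [x|] //=; exact: sedge_irr. Qed.

Definition add_vertex : sgraph := SGraph add_rel_sym add_rel_irr.

End AddVertex.

Definition star (k : nat) : sgraph :=
  @bipartite_graph unit 'I_k (fun _ _ => true).

(* The graphs S_n, R_n and Q_n are indexed by k, where n = 2k + 1. *)
Definition graph_S (k : nat) : sgraph := subdivision (star k).

(* K_(k,k) minus the perfect matching joining inl i to inr i for all i. *)
Definition graph_L (k : nat) : sgraph :=
  @bipartite_graph 'I_k 'I_k (fun i j => i != j).

Definition graph_H (k : nat) : sgraph :=
  @add_vertex (graph_L k) [set inl i | i : 'I_k].

Definition allone (r c : nat) : 'M[algC]_(r, c) := const_mx 1.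

Definition id_ones (l : nat) : 'M[algC]_(l, l + 1) := row_mx 1%:M (allone l 1).

(* graph_R k and graph_Q k are meant for 3 <= k only; for smaller k the
   truncated k - 3 yields a graph of the wrong order. *)
Definition graph_R (k : nat) : sgraph :=
  bip_graph (block_mx (1%:M : 'M_(k - 3)) (allone (k - 3) (3 + 1))
                      0                   (id_ones 3)).

Definition graph_Q (k : nat) : sgraph :=
  bip_graph (block_mx (id_ones (k - 3)) (allone (k - 3) 3)
                      0                 (allone 3 3 - 1%:M)).

Definition graph_G3 : sgraph :=
  bip_graph (block_mx (allone 4 4 - 1%:M) (allone 4 2)
                      (0 : 'M_(1, 4))     (allone 1 2)).

Definition graph_G4 : sgraph :=
  bip_graph (block_mx (allone 3 3 - 1%:M) (allone 3 (2 + 1))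
                      0                   (id_ones 2)).

(* Main.v *)
(* The remaining two eigenvalues sum to 0, since the trace does, so every odd
   power of the adjacency matrix has trace 0: there are no odd closed walks and
   G is bipartite. Let N be its bipartite adjacency matrix, with no more rows
   than columns. At most three eigenvalues differ from 1 and -1, hence
   rank (N N^T - I) + rank (N^T N - I) <= 3, while the difference of these ranks
   is the number of columns minus the number of rows. This forces N to be
   k x (k+1) with N N^T - I of rank one. The rows of N, seen as sets F x, thus
   satisfy |F x :&: F x'|^2 = (|F x| - 1)(|F x'| - 1). For |F x| < |F x'| this
   makes F x a subset of F x', and then |F x| = 2 and |F x'| = 5. Sets of equal
   size d meet in d - 1 elements; such a family either shares a common
   (d-1)-subset or lies in a common (d+1)-set. Counting the k+1 columns then
   leaves exactly the listed graphs. *)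
Require Import Defs.
From mathcomp Require Import all_boot all_order all_algebra all_field.
From mathcomp Require Import zify.

Set Implicit Arguments.
Unset Strict Implicit.
Unset Printing Implicit Defensive.

Import Order.TTheory GRing.Theory Num.Theory.
Local Open Scope ring_scope.

(** * The spectrum of the adjacency matrix *)

Lemma char_poly_conj (F : fieldType) n (P A : 'M[F]_n) :
  P \in unitmx -> char_poly (invmx P *m A *m P) = char_poly A.
Proof.
move=> Pu; rewrite /char_poly /char_poly_mx.
set Q := map_mx polyC P; have Qu : Q \in unitmx by rewrite map_unitmx.
have -> : 'X%:M - map_mx polyC (invmx P *m A *m P) =
          invmx Q *m ('X%:M - map_mx polyC A) *m Q.
  rewrite mulmxBr mulmxBl !map_mxM map_invmx; congr (_ - _).
  by rewrite scalar_mxC -mulmxA mulVmx ?mulmx1.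
by rewrite !det_mulmx mulrAC -det_mulmx mulVmx // det1 mul1r.
Qed.

Lemma diag_mxX (R : pzRingType) n (d : 'rV[R]_n) m :
  diag_mx d ^+ m = diag_mx (\row_i d 0 i ^+ m).
Proof.
elim: m => [|m IH].
  by rewrite expr0; apply/matrixP=> i j; rewrite !mxE expr0.
by rewrite exprS IH; apply/matrixP=> i j; rewrite -mulmxE mul_diag_mx !mxE exprS;
  case: eqP => [->|]; rewrite ?mulr1n ?mulr0n ?mulr0.
Qed.

Lemma conjmxX (F : fieldType) n (P A : 'M[F]_n) m :
  P \in unitmx -> (invmx P *m A *m P) ^+ m = invmx P *m A ^+ m *m P.
Proof.
move=> Pu; elim: m => [|m IH]; first by rewrite !expr0 -mulmxA mul1mx mulVmx.
by rewrite !exprS IH -!mulmxE !mulmxA mulmxK.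
Qed.

Lemma adjmx_sym (G : sgraph) : (adjmx G)^T = adjmx G.
Proof. by apply/matrixP=> i j; rewrite !mxE sedge_sym. Qed.

(** A real symmetric matrix is normal, so the spectral theorem applies; comparing characteristic
    polynomials identifies the diagonal with the spectrum. *)
Lemma adjmx_diagonalization (G : sgraph) :
  exists2 P : 'M[algC]_#|G|, P \in unitmx &
  exists2 d : 'rV[algC]_#|G|, adjmx G = invmx P *m diag_mx d *m P &
    perm_eq (spectrum G) [seq d 0 i | i <- enum 'I_#|G|].
Proof.
have AN : adjmx G \is normalmx.
  apply: symmetric_normalmx.
    by apply/is_hermitianmxP; rewrite expr0 scale1r map_mx_id // adjmx_sym.
  by apply/mxOverP=> i j; rewrite mxE realn.
have Pu := spectral_unit (adjmx G).
have /orthomx_spectralP eqA := AN.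
exists (spectralmx (adjmx G)) => //; exists (spectral_diag (adjmx G)) => //.
apply: prod_XsubC_eq; rewrite -spectrumP {1}eqA char_poly_conj //.
rewrite char_poly_trig ?diag_mx_is_trig // big_map big_enum /=.
by apply: eq_bigr => i _; rewrite !mxE eqxx mulr1n.
Qed.

Lemma mxtrace_adjmxX (G : sgraph) m :
  \tr (adjmx G ^+ m) = \sum_(z <- spectrum G) z ^+ m.
Proof.
have [P Pu [d eqA sd]] := adjmx_diagonalization G.
rewrite (perm_big _ sd) /= big_map big_enum eqA conjmxX // diag_mxX.
rewrite mxtrace_mulC mulmxA mulmxV // mul1mx mxtrace_diag.
by apply: eq_bigr => i _; rewrite mxE.
Qed.

(** A diagonal matrix is a sum of one rank-one matrix for each nonzero entry, and rank is
    subadditive. *)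
Lemma rank_diag_mx (F : fieldType) n (d : 'rV[F]_n) :
  (\rank (diag_mx d) <= count (fun i => d 0%R i != 0%R) (enum 'I_n))%N.
Proof.
have -> : diag_mx d = \sum_(i | d 0 i != 0) d 0 i *: delta_mx i i.
  rewrite diag_mx_sum_delta [LHS](bigID (fun i => d 0 i != 0)) /=.
  by rewrite [X in _ + X]big1 ?addr0 // => i /negPn /eqP ->; rewrite scale0r.
rewrite -size_filter -sum1_size big_filter big_enum_cond /=.
elim/big_ind2: _ => [|A a B b Aa Bb|i _]; first by rewrite mxrank0.
  by rewrite (leq_trans (mxrank_add _ _)) // leq_add.
by rewrite (leq_trans (mxrank_scale _ _)) // mxrank_delta.
Qed.

(** In an eigenbasis the matrix is diagonal with entries [z ^+ 2 - 1], and conjugation preserves the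
    rank. *)
Lemma rank_adjmx_sqr (G : sgraph) :
  (\rank (adjmx G ^+ 2 - 1)%R <= count (fun z => z ^+ 2 != 1)%R (spectrum G))%N.
Proof.
have [P Pu [d eqA sd]] := adjmx_diagonalization G.
rewrite (seq.permP sd) count_map eqA conjmxX // diag_mxX.
have -> : (1 : 'M[algC]_#|G|) = invmx P *m 1 *m P by rewrite mulmx1 mulVmx.
rewrite -mulmxBl -mulmxBr mxrankMfree ?row_free_unit //.
rewrite -mxrank_tr trmx_mul mxrankMfree ?row_free_unit ?unitmx_tr ?unitmx_inv //.
have -> : (1 : 'M[algC]_#|G|) = diag_mx (const_mx 1) by rewrite diag_const_mx.
rewrite mxrank_tr -raddfB /=.
apply: leq_trans (rank_diag_mx _) _.
by rewrite leq_eqVlt; apply/orP; left; apply/eqP/eq_count => i /=;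
  rewrite !mxE subr_eq0.
Qed.

Lemma size_spectrum (G : sgraph) : size (spectrum G) = #|G|.
Proof.
by have := size_char_poly (adjmx G); rewrite spectrumP size_prod_XsubC => -[].
Qed.

Section Spectrum.
Variables (G : sgraph) (m : nat).
Hypothesis cardG : #|G| = (2 * m + 3)%N.
Hypothesis specG : msubset (0 :: nseq m 1 ++ nseq m (- 1)) (spectrum G).

(* The two remaining eigenvalues are opposite because the trace is 0. *)
Lemma spectrum_shape :
  exists a : algC,
    perm_eq (spectrum G) ((0 :: nseq m 1 ++ nseq m (- 1)) ++ [:: a; - a]).
Proof.
have /count_subseqP[t /perm_to_subseq[s3 st] tt] := specG.
have {}st := perm_trans st (_ : perm_eq _ (_ ++ s3)).
move: st => /(_ (0 :: nseq m 1 ++ nseq m (- 1))).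
rewrite perm_cat2r perm_sym => /(_ tt) st.
(* The prescribed list has [2 * m + 1] entries, so [s3] consists of exactly two eigenvalues. *)
have := perm_size st; rewrite size_cat /= size_cat !size_nseq size_spectrum cardG.
case: s3 st => [|a [|b [|]]] st /=; try by clear; lia.
move=> _.
exists a; suff -> : - a = b by [].
apply/eqP; rewrite eq_sym -addr_eq0 addrC.
have : \tr (adjmx G ^+ 1) = 0.
  by rewrite expr1 /mxtrace big1 // => i _; rewrite mxE sedge_irr.
rewrite mxtrace_adjmxX (perm_big _ st) /= big_cons !big_cat /= !big_cons big_nil.
rewrite !big_nseq !iter_addr_0 !expr1 addr0 add0r mulNrn subrr add0r.
by move->.
Qed.

(** Odd powers of [1] and [- 1], and of [a] and [- a], cancel in pairs. *)
Lemma mxtrace_adjmx_odd j : odd j -> \tr (adjmx G ^+ j) = 0.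
Proof.
move=> oj; have [a ps] := spectrum_shape.
rewrite mxtrace_adjmxX (perm_big _ ps) /= big_cons !big_cat /= !big_cons big_nil.
rewrite !big_nseq !iter_addr_0 expr1n -signr_odd oj expr1 exprNn -signr_odd oj.
rewrite expr1 mulN1r addr0 mulNrn !subrr expr0n; case: j oj => //= j _.
by rewrite !addr0.
Qed.

(** Only the eigenvalues [0], [a] and [- a] can have a square other than 1. *)
Lemma rank_adjmx_sqr_le3 : (\rank (adjmx G ^+ 2 - 1)%R <= 3)%N.
Proof.
have [a ps] := spectrum_shape.
apply: leq_trans (rank_adjmx_sqr _) _; rewrite (seq.permP ps) count_cat /= count_cat.
rewrite !count_nseq /= expr1n sqrrN expr1n eqxx /= !mul0n.
by do !case: (_ == _).
Qed.

End Spectrum.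

(** * Bipartiteness *)

Lemma adjmxX_ge0 (G : sgraph) k i j : 0 <= (adjmx G ^+ k) i j.
Proof.
elim: k i j => [|k IHk] i j; first by rewrite expr0 mxE ler0n.
by rewrite exprS -mulmxE mxE sumr_ge0 // => l _; rewrite mulr_ge0 // mxE ler0n.
Qed.

(** Entries of powers count walks: the given walk contributes a positive term, and all other terms
    are nonnegative. *)
Lemma adjmxX_gt0 (G : sgraph) (x : G) (s : seq G) :
  path sedge x s ->
  0 < (adjmx G ^+ size s) (enum_rank x) (enum_rank (last x s)).
Proof.
elim: s x => [|y s IH] x /=; first by rewrite expr0 mxE eqxx.
case/andP=> exy /IH{}IH; rewrite exprS -mulmxE mxE (bigD1 (enum_rank y)) //=.
rewrite ltr_wpDr ?sumr_ge0 // => [i _|].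
  by rewrite mulr_ge0 ?adjmxX_ge0 // mxE ler0n.
by rewrite mxE !enum_rankK exy mul1r.
Qed.

(* Walks in the bipartite double cover record the parity of walks in [G]. *)
Definition cover_rel (G : sgraph) (u v : G * bool) :=
  sedge u.1 v.1 && (u.2 != v.2).

Lemma cover_relC (G : sgraph) : connect_sym (@cover_rel G).
Proof.
by apply: sym_connect_sym => -[x b] [y c]; rewrite /cover_rel /= sedge_sym eq_sym.
Qed.

Lemma connect_cover (G : sgraph) (x y : G) (b c : bool) :
  connect (@cover_rel G) (x, b) (y, c) ->
  exists s, [/\ path sedge x s, y = last x s & odd (size s) = b (+) c].
Proof.
case/connectP=> s; elim: s x b => [|[z d] s IH] x b /=.
  by move=> _ [-> ->]; exists [::]; rewrite addbb.
case/andP=> /andP[/= xz bd] /IH{}IH /IH[t [tz -> ot]].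
by exists (z :: t); rewrite /= xz tz ot; split=> //; case: (b) (c) (d) bd => [] [] [].
Qed.

(** Exchanging the two sheets is an automorphism of the double cover. *)
Lemma connect_cover_flip (G : sgraph) (x y : G) (b c : bool) :
  connect (@cover_rel G) (x, b) (y, c) -> connect (@cover_rel G) (x, ~~ b) (y, ~~ c).
Proof.
case/connectP=> s; elim: s x b => [|[z d] s IH] x b /=; first by move=> _ [-> ->].
case/andP=> /andP[/= xz bd] /IH{}IH /IH{}IH.
apply: connect_trans IH; apply: connect1; rewrite /cover_rel /= xz.
by case: (b) (d) bd => [] [].
Qed.

Lemma connect_cover_lift (G : sgraph) (x y : G) (b : bool) :
  connect sedge x y -> exists c, connect (@cover_rel G) (x, b) (y, c).
Proof.
case/connectP=> s; elim: s x b => [|z s IH] x b /=; first by move=> _ ->; exists b.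
case/andP=> xz /IH{}IH /IH - /(_ (~~ b))[c zc]; exists c.
apply: connect_trans zc; apply: connect1; rewrite /cover_rel /= xz.
by case: b.
Qed.

(** A vertex is coloured by whether a walk of odd length from [x0] reaches it. *)
Lemma odd_closed_walk_free_bipartite (G : sgraph) :
  connected G -> (forall j, odd j -> \tr (adjmx G ^+ j) = 0) ->
  exists c : G -> bool, forall x y, sedge x y -> c x != c y.
Proof.
move=> Gc tr0; have [x0|G0] := pickP G; last by exists xpredT => x; have := G0 x.
move=> _.
(* An odd closed walk at [x0] would make a diagonal entry positive, while nonnegative entries with
   sum 0 all vanish. *)
have noodd : ~~ connect (@cover_rel G) (x0, false) (x0, true).
  apply/negP=> /connect_cover[s [ps lx os]]; have := tr0 _ os.
  move=> /eqP; rewrite psumr_eq0 => [|i _]; last exact: adjmxX_ge0.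
  move=> /allP /(_ (enum_rank x0)); rewrite mem_index_enum => /(_ isT) /=.
  by rewrite gt_eqF // {2}lx adjmxX_gt0.
exists (fun x => connect (@cover_rel G) (x0, false) (x, true)) => x y xy.
have step b : connect (@cover_rel G) (x, b) (y, ~~ b).
  by apply: connect1; rewrite /cover_rel /= xy; case: b.
have [cx|cx] := boolP (connect _ _ (x, true)).
  (* If odd walks reached both ends of an edge, joining them through the edge would give an odd
     closed walk at [x0]. *)
  have cy := connect_trans cx (step true).
  apply/negP=> /eqP/esym cy'; case/negP: noodd.
  apply: connect_trans cy' _; rewrite cover_relC.
  exact: connect_cover_flip cy.
(* By connectedness [x] is reached on the even sheet, and the edge leads on to [y] on the odd
   one. *)
have [[] cx'] := connect_cover_lift false (Gc x0 x); first by rewrite cx' in cx.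
by rewrite (connect_trans cx' (step false)).
Qed.

(** * Isomorphisms, connectedness and two-colourings *)

Lemma isomorphic_sym (G H : sgraph) : isomorphic G H -> isomorphic H G.
Proof.
move=> [f [g fK gK] fE]; exists g; first by exists f.
by move=> x y; rewrite -fE !gK.
Qed.

Lemma isomorphic_trans (G H K : sgraph) :
  isomorphic G H -> isomorphic H K -> isomorphic G K.
Proof.
move=> [f bf fE] [g bg gE]; exists (g \o f); first exact: bij_comp.
by move=> x y; rewrite /= gE fE.
Qed.

Lemma connected_isomorphic (G H : sgraph) :
  isomorphic G H -> connected G -> connected H.
Proof.
move=> [f [g fK gK] fE] Gc x y; have /connectP[s ps ly] := Gc (g x) (g y).
apply/connectP; exists (map f s); last by rewrite -[x]gK last_map -ly gK.
rewrite -[x]gK path_map; apply: sub_path ps => u v /=.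
by rewrite fE.
Qed.

(** Applied below to sets of one and two vertices, to exclude isolated vertices and isolated
    edges. *)
Lemma connected_closed (G : sgraph) (p : pred G) (x : G) :
  connected G -> p x -> (forall u v, p u -> sedge u v -> p v) -> forall y, p y.
Proof.
move=> Gc px pE y; have /connectP[s + ->] := Gc x y.
by elim: s x px => //= z s IH x px /andP[/(pE _ _ px) pz /(IH _ pz)].
Qed.

Lemma bipartite_colouring (G : sgraph) (c : G -> bool) :
  (forall x y, sedge x y -> c x != c y) ->
  isomorphic (@bipartite_graph {x | c x} {x | ~~ c x}
                               (fun x y => sedge (val x) (val y))) G.
Proof.
move=> cE; pose f (u : {x | c x} + {x | ~~ c x}) :=
  match u with inl x => val x | inr y => val y end.
exists f; last first.
  case=> [[x cx]|[x cx]] [[y cy]|[y cy]] //=.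
  - by apply/negP=> /cE; rewrite cx cy.
  - by rewrite sedge_sym.
  - by apply/negP=> /cE; rewrite (negPf cx) (negPf cy).
have fI : injective f.
  case=> x [] y /= xy.
  by congr inl; exact: val_inj.
     by case/negP: (svalP y); rewrite -xy (svalP x).
     by case/negP: (svalP x); rewrite xy (svalP y).
    by congr inr; exact: val_inj.
apply: inj_card_bij => //; rewrite card_sum !card_sig addnC.
rewrite -(cardC c) addnC leq_add //; by apply: eq_leq; apply: eq_card => x; rewrite !inE.
Qed.

Lemma bipartite_swap (X Y : finType) (r : X -> Y -> bool) :
  isomorphic (bipartite_graph r) (bipartite_graph (fun y x => r x y)).
Proof.
pose f (S T : finType) (u : S + T) : T + S :=
  match u with inl x => inr x | inr y => inl y end.
exists (@f X Y); first by exists (@f Y X); case.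
by case=> ? [].
Qed.

(** * The bipartite adjacency matrix *)

Definition bip_mx (X Y : finType) (r : X -> Y -> bool) : 'M[algC]_(#|X|, #|Y|) :=
  \matrix_(i, j) (r (enum_val i) (enum_val j))%:R.

Lemma rank_mxsub (F : fieldType) m n m' n' (f : 'I_m' -> 'I_m) (g : 'I_n' -> 'I_n)
    (A : 'M[F]_(m, n)) :
  (\rank (mxsub f g A) <= \rank A)%N.
Proof.
rewrite mxsubrc rowsubE; apply: leq_trans (mxrankM_maxr _ _) _.
by rewrite -[A in colsub _ A]mulmx1 -mulmx_colsub mxrankM_maxl.
Qed.

(** In the vertex order [h] the adjacency matrix becomes [block_mx 0 N N^T 0], and its square minus
    1 is block diagonal with the two matrices on the left as blocks. *)
Lemma rank_bip_mx (X Y : finType) (r : X -> Y -> bool) (G : sgraph)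
    (N := bip_mx r) :
  isomorphic (bipartite_graph r) G ->
  (\rank (N *m N^T - 1%:M)%R + \rank (N^T *m N - 1%:M)%R
    <= \rank (adjmx G ^+ 2 - 1)%R)%N.
Proof.
move=> [f bf fE]; have [g fK gK] := bf.
pose e (i : 'I_(#|X| + #|Y|)) : X + Y :=
  match split i with inl i => inl (enum_val i) | inr j => inr (enum_val j) end.
pose e' (u : X + Y) : 'I_(#|X| + #|Y|) :=
  match u with inl x => lshift _ (enum_rank x) | inr y => rshift _ (enum_rank y) end.
have eK : cancel e e'.
  move=> i; rewrite /e -[i in RHS]splitK; case: (split i) => j /=;
  by rewrite enum_valK.
have e'K : cancel e' e.
  by case=> x; rewrite /e /e' ?(unsplitK (inl _)) ?(unsplitK (inr _)) enum_rankK.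
pose h i := enum_rank (f (e i)).
have hb : bijective h.
  exists (fun j => e' (g (enum_val j))) => i; rewrite /h ?enum_rankK ?fK ?eK //.
  by rewrite e'K gK enum_valK.
have hI := bij_inj hb.
rewrite -rank_diag_block_mx; apply: leq_trans (rank_mxsub h h _).
apply: eq_leq; congr (\rank _); pose B : 'M[algC]_(#|X| + #|Y|) := block_mx 0 N N^T 0.
have BE : mxsub h h (adjmx G) = B.
  apply/matrixP=> i j; rewrite !mxE !enum_rankK fE /e.
  case: (split i) => i'; rewrite !mxE; case: (split j) => j' //=; by rewrite !mxE.
transitivity (B *m B - 1%:M).
  rewrite mulmx_block !mul0mx !mulmx0 !addr0 !add0r -[1%:M in RHS]submxK.
  by rewrite opp_block_mx add_block_mx; congr block_mx;
    apply/matrixP=> i j; rewrite !mxE ?eq_lshift ?eq_rshift ?eq_lrshift ?eq_rlshift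
     ?subr0 ?oppr0 ?subrr.
rewrite -BE; apply/matrixP=> i j; rewrite !mxE (inj_eq hI); congr (_ - _).
rewrite [RHS](reindex h) //=; last exact: onW_bij.
by apply: eq_bigr => l _; rewrite !mxE.
Qed.

(** Both sides equal the rank of [B], computed through the Schur complement of one or the other of
    its identity blocks. *)
Lemma rank_gram_diff (F : fieldType) m n (N : 'M[F]_(m, n)) :
  (\rank (N^T *m N - 1%:M)%R + m = \rank (N *m N^T - 1%:M)%R + n)%N.
Proof.
pose B := block_mx (1%:M : 'M_m) N N^T (1%:M : 'M_n).
have rkB1 : \rank B = (m + \rank (1%:M - N^T *m N)%R)%N.
  have -> : B = block_mx 1%:M 0 N^T 1%:M *m block_mx 1%:M 0 0 (1%:M - N^T *m N)
                *m block_mx 1%:M N 0 1%:M.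
    by rewrite !mulmx_block !(mul0mx, mulmx0, mul1mx, mulmx1, addr0, add0r) addrC subrK.
  rewrite mxrankMfree; last by rewrite row_free_unit unitmxE det_ublock !det1 mul1r unitr1.
  rewrite eqmxMfull; last by rewrite row_full_unit unitmxE det_lblock !det1 mul1r unitr1.
  by rewrite rank_diag_block_mx mxrank1.
have rkB2 : \rank B = (\rank (1%:M - N *m N^T)%R + n)%N.
  have -> : B = block_mx 1%:M N 0 1%:M *m block_mx (1%:M - N *m N^T) 0 0 1%:M
                *m block_mx 1%:M 0 N^T 1%:M.
    by rewrite !mulmx_block !(mul0mx, mulmx0, mul1mx, mulmx1, addr0, add0r) subrK.
  rewrite mxrankMfree; last by rewrite row_free_unit unitmxE det_lblock !det1 mul1r unitr1.
  rewrite eqmxMfull; last by rewrite row_full_unit unitmxE det_ublock !det1 mul1r unitr1.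
  by rewrite rank_diag_block_mx mxrank1.
rewrite -[X in \rank X]opprB mxrank_opp -[X in (_ = \rank X + _)%N]opprB mxrank_opp.
by rewrite addnC -rkB1 rkB2.
Qed.

(** A matrix of rank at most one is zero or a column times a row. *)
Lemma rank_le1_minor (F : fieldType) m n (M : 'M[F]_(m, n)) i j k l :
  (\rank M <= 1)%N -> M i j * M k l = M i l * M k j.
Proof.
have := mulmx_base M; move: (col_base M) (row_base M).
case: (\rank M) => [|[|//]] C R <- _; rewrite !mxE ?big_ord0 ?mul0r //.
by rewrite !big_ord1 mulrACA [RHS]mulrACA [R 0 j * _]mulrC.
Qed.

Lemma bip_mx_gram (X Y : finType) (r : X -> Y -> bool) i j :
  (bip_mx r *m (bip_mx r)^T) i j =
  #|[set y | r (enum_val i) y] :&: [set y | r (enum_val j) y]|%:R.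
Proof.
rewrite mxE -sum1_card natr_sum [RHS]big_mkcond.
rewrite [RHS](reindex (@enum_val Y Y)) /=; last first.
  by apply: onW_bij; exact: enum_val_bij.
apply: eq_bigr => l _; rewrite !mxE !inE.
by case: (r _ _); case: (r _ _); rewrite ?mul1r ?mul0r ?mulr0.
Qed.

(* Entrywise form of the rank-one condition on [N *m N^T - 1]. *)
Definition near_orthogonal (X Y : finType) (F : X -> {set Y}) :=
  forall x x', x != x' ->
    (#|F x :&: F x'| ^ 2 = (#|F x| - 1) * (#|F x'| - 1))%N.

Definition nbr (X Y : finType) (r : X -> Y -> bool) (x : X) := [set y | r x y].

Lemma bip_nbr_gt0 (X Y : finType) (r : X -> Y -> bool) :
  connected (bipartite_graph r) -> (1 < #|X| + #|Y|)%N ->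
  forall x, (0 < #|nbr r x|)%N.
Proof.
move=> Gc card_gt1 x; rewrite card_gt0; apply: contraTneq card_gt1 => Fx0.
rewrite -card_sum -leqNgt.
apply: leq_trans (_ : #|pred1 (inl x : X + Y)| <= 1)%N; last first.
  by rewrite card1.
apply: subset_leq_card; apply/subsetP=> u _; rewrite !inE.
apply: (@connected_closed (bipartite_graph r) (pred1 (inl x)) (inl x)) => //=.
move=> v w /eqP-> /=; case: w => // y xy.
by have := in_set0 y; rewrite -Fx0 inE xy.
Qed.

(** The vertex and its only neighbour form a set closed under adjacency, hence the whole graph. *)
Lemma bip_nbr1 (X Y : finType) (r : X -> Y -> bool) x :
  connected (bipartite_graph r) -> #|nbr r x| = 1%N ->
  (forall x', x != x' -> nbr r x :&: nbr r x' = set0) -> (#|X| + #|Y| <= 2)%N.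
Proof.
move=> Gc /eqP/cards1P[y Fx] disj; rewrite -card_sum.
apply: leq_trans (_ : #|pred2 (inl x : X + Y) (inr y)| <= 2)%N; last first.
  by rewrite card2.
apply: subset_leq_card; apply/subsetP=> u _; rewrite !inE.
apply: (@connected_closed (bipartite_graph r) (pred2 (inl x) (inr y)) (inl x)) => //=.
  by rewrite eqxx.
have rE z : r x z = (z == y) by have := in_set1 z y; rewrite -Fx inE.
move=> v w /pred2P[]-> /=; case: w => // w.
  by rewrite rE => /eqP->; rewrite eqxx orbT.
move=> wy.
have [->|nwx] := eqVneq x w; first by rewrite eqxx.
by have /setP/(_ y) := disj w nwx; rewrite !inE rE eqxx wy.
Qed.

Lemma near_orthogonal_bipartition (G : sgraph) (m : nat) :
  connected G -> #|G| = (2 * m + 3)%N ->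
  msubset (0 :: nseq m 1 ++ nseq m (- 1)) (spectrum G) ->
  exists (X Y : finType) (r : X -> Y -> bool),
    [/\ isomorphic (bipartite_graph r) G, (#|X| = m.+1 /\ #|Y| = m.+2),
        forall x, (1 < #|nbr r x|)%N, near_orthogonal (nbr r)
      & forall y, exists x, y \in nbr r x].
Proof.
move=> Gc cardG specG.
(* The two sides may be exchanged, so the smaller one can index the rows. *)
suff key (X Y : finType) (r : X -> Y -> bool) :
    isomorphic (bipartite_graph r) G -> (#|X| <= #|Y|)%N ->
    [/\ (#|X| = m.+1 /\ #|Y| = m.+2), forall x, (1 < #|nbr r x|)%N,
        near_orthogonal (nbr r) & forall y, exists x, y \in nbr r x].
  have [c cE] := odd_closed_walk_free_bipartite Gc (mxtrace_adjmx_odd cardG specG).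
  have [X [Y [r iso]]] : exists (X Y : finType) (r : X -> Y -> bool),
      isomorphic (bipartite_graph r) G.
    by do 3!eexists; exact: bipartite_colouring cE.
  have iso' := isomorphic_trans (bipartite_swap _) iso.
  have [XY|/ltnW YX] := leqP #|X| #|Y|.
    by have [? ? ? ?] := key _ _ _ iso XY; exists X, Y, r; split.
  by have [? ? ? ?] := key _ _ _ iso' YX; exists Y, X, (fun y x => r x y); split.
move=> iso leXY.
have Bc := connected_isomorphic (isomorphic_sym iso) Gc.
have cardXY : (#|X| + #|Y| = 2 * m + 3)%N.
  by rewrite -cardG -card_sum; have [f bf _] := iso; exact: bij_eq_card bf.
pose N := bip_mx r; pose D := N *m N^T - 1%:M; pose E := N^T *m N - 1%:M.
have rk : (\rank D + \rank E <= 3)%N.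
  exact: leq_trans (rank_bip_mx iso) (rank_adjmx_sqr_le3 cardG specG).
have dk : (\rank E + #|X| = \rank D + #|Y|)%N := rank_gram_diff N.
have F_gt0 : forall x, (0 < #|nbr r x|)%N by apply: bip_nbr_gt0 => //; lia.
have DE x x' : D (enum_rank x) (enum_rank x') =
    #|nbr r x :&: nbr r x'|%:R - (x == x')%:R.
  by rewrite mxE bip_mx_gram !enum_rankK !mxE (inj_eq enum_rank_inj).
have Dd x : D (enum_rank x) (enum_rank x) = (#|nbr r x| - 1)%:R.
  by rewrite DE setIid eqxx natrB.
(* The order is odd, so [#|X| < #|Y|], and [dk] gives [\rank D < \rank E]; the two ranks sum to at
   most 3. *)
have rkD : (\rank D <= 1)%N by lia.
have NO : near_orthogonal (nbr r).
  move=> x x' xx'.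
  have := rank_le1_minor (enum_rank x) (enum_rank x') (enum_rank x') (enum_rank x) rkD.
  rewrite !Dd !DE [x' == x]eq_sym (negPf xx') !subr0 setIC -!natrM mulnn => /eqP.
  by rewrite eqr_nat => /eqP.
(* By near-orthogonality a neighbourhood of size 1 would be disjoint from all the others. *)
have F_gt1 x : (1 < #|nbr r x|)%N.
  rewrite ltn_neqAle F_gt0 andbT; apply/negP=> /eqP Fx.
  suff : (#|X| + #|Y| <= 2)%N by lia.
  apply: bip_nbr1 Bc (esym Fx) _ => x' /NO/eqP; rewrite -Fx mul0n expn_eq0 andbT.
  by rewrite cards_eq0 => /eqP.
have cover y : exists x, y \in nbr r x.
  have Bc' := connected_isomorphic (bipartite_swap _) Bc.
  have : (0 < #|nbr (fun y x => r x y) y|)%N by apply: bip_nbr_gt0 => //; lia.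
  by rewrite card_gt0 => /set0Pn[x]; rewrite inE => ?; exists x; rewrite inE.
split=> //; suff : #|Y| = #|X|.+1 by lia.
(* Once [D] is nonzero, the rank relations leave only a difference of one. It is nonzero because its
   diagonal entries are degrees minus 1. *)
have [D0|] := posnP (\rank D); last by clear -dk rk cardXY leXY; lia.
have /card_gt0P[y _] : (0 < #|Y|)%N by lia.
have [x _] := cover y; have := Dd x.
move/eqP: D0; rewrite mxrank_eq0 => /eqP->; rewrite mxE => /esym/eqP.
by rewrite pnatr_eq0 subn_eq0 leqNgt F_gt1.
Qed.

(** * Families of sets meeting in all but one element *)

Local Open Scope nat_scope.

Lemma eq_setU1D1 (T : finType) (A B : {set T}) :
  B \subset A -> #|A| = #|B|.+1 -> exists y, [/\ y \notin B & A = y |: B].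
Proof.
move=> BA cA; have /eqP/cards1P[y Dy] : #|A :\: B| = 1.
  by rewrite cardsD (setIidPr BA) cA subSnn.
exists y; have := set11 y; rewrite -Dy inE => /andP[yB _]; split=> //.
by rewrite setUC -{1}(setIidPr BA) setID.
Qed.

Section NearFamily.
Variables (X Y : finType) (F : X -> {set Y}) (P : {set X}) (d : nat).

(** Together with [cosimplex], the two shapes of a clique in the Johnson graph of [d.+1]-sets; here
    [g x] is the petal of [x]. *)
Definition sunflower (K : {set Y}) (g : X -> Y) :=
  [/\ {in P &, injective g}, #|K| = d
    & forall x, x \in P -> g x \notin K /\ F x = g x |: K].

(** Facets of the simplex on [W], each recorded by its opposite vertex [g x]. *)
Definition cosimplex (W : {set Y}) (g : X -> Y) :=
  [/\ {in P &, injective g}, #|W| = d.+2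
    & forall x, x \in P -> g x \in W /\ F x = W :\ g x].

End NearFamily.

(** Two members fix [K] and [W], their intersection and union. A member not containing [K] lies in
    [W], and one such member forces all the others into [W]. Families of at most two sets are
    treated as sunflowers, whence [2 < #|P|] in the other case; [U] is a common part that the kernel
    must keep. *)
Lemma near_family (X Y : finType) (F : X -> {set Y}) (P : {set X}) (d : nat)
    (U : {set Y}) :
  P != set0 -> #|U| <= d ->
  (forall x, x \in P -> #|F x| = d.+1) -> (forall x, x \in P -> U \subset F x) ->
  (forall x x', x \in P -> x' \in P -> x != x' -> #|F x :&: F x'| = d) ->
  (exists (K : {set Y}) (g : X -> Y), U \subset K /\ sunflower F P d K g)
  \/ (exists (W : {set Y}) (g : X -> Y), 2 < #|P| /\ cosimplex F P d W g).
Proof.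
move=> P0 cU cF UF cFI.
have FI : {in P &, injective F}.
  move=> x x' Px Px' eqF; apply/eqP/negPn/negP=> /(cFI _ _ Px Px').
  by rewrite eqF setIid cF // => /eqP; rewrite eqn_leq ltnn.
have [x1 Px1] := set0Pn _ P0.
have /card_gt0P[y0 _] : 0 < #|F x1| by rewrite cF.
have sun (K : {set Y}) : U \subset K -> #|K| = d -> (forall x, x \in P -> K \subset F x) ->
    exists (K : {set Y}) (g : X -> Y), U \subset K /\ sunflower F P d K g.
  move=> UK cK KF.
  have /fin_all_exists[g gE] x : exists y, x \in P -> y \notin K /\ F x = y |: K.
    (* Outside [P] the value [y0] is a default. *)
    have [Px|] := boolP (x \in P); last by exists y0.
    by have [|y [yK Fx]] := eq_setU1D1 (KF x Px); [rewrite cF ?cK | exists y].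
  exists K, g; split=> //; split=> // x x' Px Px' eqg; apply: FI => //.
  by rewrite (gE x Px).2 (gE x' Px').2 eqg.
have cos (W : {set Y}) : #|W| = d.+2 -> 2 < #|P| -> (forall x, x \in P -> F x \subset W) ->
    exists (W : {set Y}) (g : X -> Y), 2 < #|P| /\ cosimplex F P d W g.
  move=> cW P3 FW.
  have /fin_all_exists[g gE] x : exists y, x \in P -> y \in W /\ F x = W :\ y.
    have [Px|] := boolP (x \in P); last by exists y0.
    have [|y [yF Wy]] := eq_setU1D1 (FW x Px); first by rewrite cF.
    by exists y; rewrite Wy setU11 setU1K.
  exists W, g; split=> //; split=> // x x' Px Px' eqg; apply: FI => //.
  by rewrite (gE x Px).2 (gE x' Px').2 eqg.
(* For a single set, the kernel drops one element outside [U], which exists because [#|U| <= d]. *)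
have [P1|P2] := leqP #|P| 1.
  have PE : P = [set x1].
    by apply/eqP; rewrite eq_sym eqEcard sub1set Px1 cards1.
  have /subsetPn[y yF yU] : ~~ (F x1 \subset U).
    by apply/negP=> /subset_leq_card; rewrite cF // ltnNge cU.
  left; apply: (sun (F x1 :\ y)).
  - by rewrite subsetD1 UF.
  - by have := cardsD1 y (F x1); rewrite yF cF // => -[].
  - by move=> x; rewrite PE => /set1P->; rewrite subD1set.
have [x2 /setD1P[nx21 Px2]] : exists x2, x2 \in P :\ x1.
  by apply/set0Pn; rewrite -card_gt0; have := cardsD1 x1 P; rewrite Px1; lia.
pose K := F x1 :&: F x2; pose W := F x1 :|: F x2.
have cK : #|K| = d by rewrite cFI // eq_sym.
have cW : #|W| = d.+2 by rewrite cardsU !cF // -/K cK; lia.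
(* [F x] meets [F x1] and [F x2] in [d] elements each but [K] in fewer than [d], so
   inclusion-exclusion puts all its [d.+1] elements in [W]. *)
have KW x : x \in P -> ~~ (K \subset F x) -> F x \subset W.
  move=> Px nK.
  have nx1 : x != x1 by apply: contraNneq nK => ->; rewrite subsetIl.
  have nx2 : x != x2 by apply: contraNneq nK => ->; rewrite subsetIr.
  have KlF : #|F x :&: K| < d.
    by rewrite -cK proper_card // properE subsetIr subsetI subxx andbT.
  apply/setIidPl/eqP; rewrite eqEcard subsetIl cF //.
  have := cardsU (F x :&: F x1) (F x :&: F x2).
  rewrite -setIUr -/W -setIIr -/K !cFI //; lia.
have [/forall_inP KF|/forall_inPn[x3 Px3 nK3]] := boolP [forall x in P, K \subset F x].
  by left; apply: (sun K) => //; rewrite subsetI !UF.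
right; apply: (cos W) => // [|x Px].
  have nx1 : x1 != x3 by apply: contraNneq nK3 => <-; rewrite subsetIl.
  have nx2 : x2 != x3 by apply: contraNneq nK3 => <-; rewrite subsetIr.
  apply: leq_trans (_ : #|x1 |: [set x2; x3]| <= _).
    by rewrite cardsU1 cards2 !inE negb_or [x1 == x2]eq_sym nx21 nx1 nx2.
  by apply/subset_leq_card/subsetP=> z /setU1P[->|/set2P[]->].
have [KF|/KW->//] := boolP (K \subset F x).
have nx3 : x != x3 by apply: contraNneq nK3 => <-.
have F3W := KW _ Px3 nK3.
have [y [yK Fx]] := eq_setU1D1 KF (etrans (cF x Px) (congr1 S (esym cK))).
rewrite Fx subUset sub1set (subset_trans (subsetIl _ _) (subsetUl _ _)) andbT.
(* If [y] were outside [W], then [F x] and [F x3] would meet only inside [K], and by size [F x3]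
   would contain [K]. *)
apply: contraNT nK3 => yW; suff -> : K = F x :&: F x3 by rewrite subsetIr.
apply/eqP; rewrite eq_sym eqEcard cK cFI // leqnn andbT Fx.
apply/subsetP=> z /setIP[/setU1P[->|//]] /(subsetP F3W); by rewrite (negPf yW).
Qed.

(** * Isomorphisms *)

Lemma bipartite_isomorphic (X Y X' Y' : finType) (r : X -> Y -> bool)
    (r' : X' -> Y' -> bool) (f : X' -> X) (g : Y' -> Y) :
  injective f -> injective g -> #|X| <= #|X'| -> #|Y| <= #|Y'| ->
  (forall x y, r (f x) (g y) = r' x y) ->
  isomorphic (bipartite_graph r) (bipartite_graph r').
Proof.
move=> fI gI cX cY fgE; apply: isomorphic_sym.
have [f' fK f'K] := inj_card_bij fI cX; have [g' gK g'K] := inj_card_bij gI cY.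
exists (fun u : X' + Y' => match u with inl x => inl (f x) | inr y => inr (g y) end).
  exists (fun u : X + Y => match u with inl x => inl (f' x) | inr y => inr (g' y) end);
  by case=> u; rewrite ?fK ?gK ?f'K ?g'K.
by case=> x [] y //=; rewrite fgE.
Qed.

(** [c] is the centre of the star and [g x] a leaf; the row [x] is the vertex subdividing the edge
    between them. *)
Lemma isomorphic_S (X Y : finType) (r : X -> Y -> bool) (c : Y) (g : X -> Y) :
  injective g -> (forall x, g x != c) -> #|Y| = #|X|.+1 ->
  (forall x y, r x y = (y == c) || (y == g x)) ->
  isomorphic (bipartite_graph r) (graph_S #|X|).
Proof.
move=> gI gc cY rE.
pose sv := star #|X|; pose v (y : sv) : Y :=
  match y with inl _ => c | inr i => g (enum_val i) end.
pose ed (i : 'I_#|X|) : {set sv} := [set inl tt; inr i].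
have edP i : ed i \in edges sv by apply/imsetP; exists (inl tt, inr i); rewrite ?inE.
pose e (x : X) : {A : {set sv} | A \in edges sv} :=
  exist _ (ed (enum_rank x)) (edP _).
have eI : injective e.
  move=> x x' /(congr1 val) /= /setP/(_ (inr (enum_rank x))).
  by rewrite !inE eqxx => /esym /= /eqP[/enum_rank_inj].
(* Every edge of the star is some [ed i], so counting makes [e] bijective. *)
have [|e' eK e'K] := inj_card_bij eI.
  rewrite card_sig -[X in _ <= X]card_ord; apply: leq_trans (leq_imset_card ed _).
  apply/subset_leq_card/subsetP=> A /imsetP[p].
  rewrite inE; case: p => [[[]|i] [[]|j]] // _ ->.
    by apply/imsetP; exists j.
  by apply/imsetP; exists i; rewrite //= setUC.
apply: isomorphic_trans (bipartite_swap _) _.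
apply: (bipartite_isomorphic (f := v) (g := e')).
- case=> [[]|i] [[]|j] //= /eqP; rewrite ?(negPf (gc _)) //.
    by rewrite eq_sym (negPf (gc _)).
  by move/eqP/gI/enum_val_inj->.
- exact: can_inj e'K.
- by rewrite cY card_sum card_unit card_ord.
- exact: leq_card eI.
- move=> y A; rewrite -[A in RHS]e'K rE !inE.
  case: y => [[]|i] /=; first by rewrite eqxx.
  by rewrite (negPf (gc _)) (inj_eq gI) -(inj_eq enum_rank_inj) enum_valK.
Qed.

(** [c] is the added vertex, and [g x] is the partner of [x] in the removed perfect matching. *)
Lemma isomorphic_H (X Y : finType) (r : X -> Y -> bool) (c : Y) (g : X -> Y) :
  injective g -> (forall x, g x != c) -> #|Y| = #|X|.+1 ->
  (forall x y, r x y = (y != g x)) ->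
  isomorphic (bipartite_graph r) (graph_H #|X|).
Proof.
move=> gI gc cY rE; apply: isomorphic_sym.
pose f (u : graph_H #|X|) : bipartite_graph r := match u with
  | None => inr c
  | Some (inl i) => inl (enum_val i)
  | Some (inr i) => inr (g (enum_val i)) end.
have imE (i : 'I_#|X|) : inl i \in [set inl j | j : 'I_#|X|] by apply: imset_f.
have imF (i : 'I_#|X|) : inr i \in [set inl j | j : 'I_#|X|] = false.
  by apply/negbTE/imsetP=> -[].
exists f; last first.
  case=> [[i|i]|] [[j|j]|] //=; rewrite ?rE ?imE ?imF //.
  - by rewrite (inj_eq gI) (inj_eq enum_val_inj) eq_sym.
  - by rewrite eq_sym gc.
  - by rewrite (inj_eq gI) (inj_eq enum_val_inj) eq_sym.
  - by rewrite eq_sym gc.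
apply: inj_card_bij; last by rewrite card_option !card_sum !card_ord cY addnS.
case=> [[i|i]|] [[j|j]|] //= [];
  try by move/eqP; rewrite ?(negPf (gc _)) // eq_sym (negPf (gc _)).
  by move/enum_val_inj->.
by move/gI/enum_val_inj->.
Qed.

Lemma isomorphic_bip_graph (X Y : finType) (r : X -> Y -> bool) p q
    (N : 'M[algC]_(p, q)) (f : 'I_p -> X) (g : 'I_q -> Y) :
  injective f -> injective g -> #|X| = p -> #|Y| = q ->
  (forall i j, r (f i) (g j) = (N i j == 1%R)) ->
  isomorphic (bipartite_graph r) (bip_graph N).
Proof. by move=> ? ? cX cY; apply: bipartite_isomorphic; rewrite ?card_ord ?cX ?cY. Qed.

(** Lists rows or columns in the block order of [block_mx]. *)
Definition split_fun (T : Type) p q (f : 'I_p -> T) (g : 'I_q -> T) (i : 'I_(p + q)) :=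
  match split i with inl j => f j | inr j => g j end.

Lemma split_fun_inj (T : Type) p q (f : 'I_p -> T) (g : 'I_q -> T) :
  injective f -> injective g -> (forall i j, f i <> g j) -> injective (split_fun f g).
Proof.
move=> fI gI fg i j; rewrite /split_fun -{2}[i]splitK -{2}[j]splitK.
by case: (split i) => i'; case: (split j) => j';
  do ?[move/fI->|move/fg|move/esym/fg|move/gI->].
Qed.

Lemma set_ord_enum (T : finType) (A : {set T}) n :
  #|A| = n -> exists2 f : 'I_n -> T, injective f & forall i, f i \in A.
Proof.
by move=> <-; exists enum_val => [|i]; [exact: enum_val_inj | exact: enum_valP].
Qed.

Lemma isomorphic_block (X Y : finType) (r : X -> Y -> bool) p1 p2 q1 q2
    (A : 'M[algC]_(p1, q1)) (B : 'M[algC]_(p1, q2))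
    (C : 'M[algC]_(p2, q1)) (D : 'M[algC]_(p2, q2))
    (f1 : 'I_p1 -> X) (f2 : 'I_p2 -> X) (g1 : 'I_q1 -> Y) (g2 : 'I_q2 -> Y) :
  [/\ injective f1, injective f2 & forall i j, f1 i <> f2 j] ->
  [/\ injective g1, injective g2 & forall i j, g1 i <> g2 j] ->
  #|X| = p1 + p2 -> #|Y| = q1 + q2 ->
  (forall i j, r (f1 i) (g1 j) = (A i j == 1%R)) ->
  (forall i j, r (f1 i) (g2 j) = (B i j == 1%R)) ->
  (forall i j, r (f2 i) (g1 j) = (C i j == 1%R)) ->
  (forall i j, r (f2 i) (g2 j) = (D i j == 1%R)) ->
  isomorphic (bipartite_graph r) (bip_graph (block_mx A B C D)).
Proof.
move=> [f1I f2I f12] [g1I g2I g12] cX cY rA rB rC rD.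
apply: (isomorphic_bip_graph (f := split_fun f1 f2) (g := split_fun g1 g2)) => //;
  try exact: split_fun_inj.
move=> i j; rewrite /split_fun !mxE.
by case: (split i) => i'; rewrite !mxE; case: (split j) => j'.
Qed.

Lemma allone_eq1 p q (i : 'I_p) (j : 'I_q) : (allone p q i j == 1%R) = true.
Proof. by rewrite mxE eqxx. Qed.

Lemma zero_eq1 p q (i : 'I_p) (j : 'I_q) : ((0%R : 'M[algC]_(p, q)) i j == 1%R) = false.
Proof. by rewrite mxE eq_sym oner_eq0. Qed.

Lemma id_eq1 p (i j : 'I_p) : ((1%:M : 'M[algC]_p)%R i j == 1%R) = (i == j).
Proof. by rewrite mxE; case: (i == j); rewrite ?eqxx // eq_sym oner_eq0. Qed.

Lemma allone_sub_id_eq1 p (i j : 'I_p) : ((allone p p - 1%:M)%R i j == 1%R) = (i != j).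
Proof.
rewrite !mxE; case: (i == j); last by rewrite subr0 eqxx.
by rewrite subrr eq_sym oner_eq0.
Qed.

Lemma id_ones_eq1 p (i : 'I_p) (j : 'I_(p + 1)) :
  (id_ones p i j == 1%R) = if split j is inl k then i == k else true.
Proof.
by rewrite mxE; case: (split j) => k; rewrite ?id_eq1 ?allone_eq1.
Qed.

(** * Classification *)

Section Mixed.
Variables (X Y : finType) (r : X -> Y -> bool).
Let F := nbr r.
Let P2 := [set x | #|F x| == 2].
Let P5 := [set x | #|F x| == 5].
Hypotheses (P25 : forall x, (x \in P2) || (x \in P5)).
Hypotheses (P2n0 : P2 != set0) (P5n0 : P5 != set0).
Hypotheses (F_no : near_orthogonal F) (F_cover : forall y, exists x, y \in F x).
Hypothesis cY : #|Y| = #|X|.+1.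

Let cF2 x : x \in P2 -> #|F x| = 2. Proof. by rewrite inE => /eqP. Qed.
Let cF5 x : x \in P5 -> #|F x| = 5. Proof. by rewrite inE => /eqP. Qed.

Let cP : #|P2| + #|P5| = #|X|.
Proof.
have -> : P5 = ~: P2.
  apply/setP=> x; have := P25 x; rewrite !inE.
  by case: eqP => [->|_ /= ->].
exact: cardsC.
Qed.

Let P25_neq x x' : x \in P2 -> x' \in P5 -> x <> x'.
Proof. by move=> /cF2 + /cF5 + eqx; rewrite eqx => ->. Qed.

Let cFI2 x x' : x \in P2 -> x' \in P2 -> x != x' -> #|F x :&: F x'| = 1.
Proof.
by move=> /cF2 c2 /cF2 c2' /F_no/eqP; rewrite c2 c2' -[_ * _]/(1 ^ 2) eqn_exp2r => // /eqP.
Qed.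

Let cFI5 x x' : x \in P5 -> x' \in P5 -> x != x' -> #|F x :&: F x'| = 4.
Proof.
by move=> /cF5 c2 /cF5 c2' /F_no/eqP; rewrite c2 c2' -[_ * _]/(4 ^ 2) eqn_exp2r => // /eqP.
Qed.

(** The squared intersection size is [(2 - 1) * (5 - 1)], so the intersection has two elements and
    is all of [F x]. *)
Let F25 x x' : x \in P2 -> x' \in P5 -> F x \subset F x'.
Proof.
move=> Px Px'; have /F_no/eqP : x != x' by apply/eqP; apply: P25_neq.
rewrite cF2 // cF5 // -[_ * _]/(2 ^ 2) eqn_exp2r // => /eqP c2.
by apply/setIidPl/eqP; rewrite eqEcard subsetIl c2 cF2.
Qed.

Let U := \bigcup_(x in P2) F x.

Let UF5 x : x \in P5 -> U \subset F x.
Proof. by move=> Px; apply/bigcupsP=> x' Px'; apply: F25. Qed.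

(** Pairs meeting two by two in a point form a star or a triangle. In the second case [g] embeds
    [P2] into the three-element [W], hence the exact count. *)
Let small : 
  (exists (K : {set Y}) (g : X -> Y), sunflower F P2 1 K g)
  \/ (exists (W : {set Y}) (g : X -> Y), #|P2| = 3 /\ cosimplex F P2 1 W g).
Proof.
have [||[K [g [_ KP]]]|[W [g [P3 WP]]]] :=
  near_family (U := set0) (d := 1) P2n0 _ cF2 _ cFI2.
- by rewrite cards0.
- by move=> x _; apply: sub0set.
- by left; exists K, g.
right; exists W, g; split=> //; case: WP => gI cW WP.
apply/eqP; rewrite eqn_leq P3 andbT -cW -(card_in_imset gI).
by apply/subset_leq_card/subsetP=> _ /imsetP[x /WP[? _] ->].
Qed.

Let UE_sun c g : sunflower F P2 1 [set c] g -> U = c |: g @: P2.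
Proof.
case=> _ _ FE; apply/setP=> y; rewrite !inE; apply/bigcupP/orP.
  case=> x Px; rewrite (FE x Px).2 !inE => /orP[/eqP->|yc]; last by left.
  by right; apply: imset_f.
case=> [/eqP->|/imsetP[x Px ->]]; last by exists x; rewrite // (FE x Px).2 setU11.
by have [x Px] := set0Pn _ P2n0; exists x; rewrite // (FE x Px).2 !inE eqxx orbT.
Qed.

Let UE_tri W g : #|P2| = 3 -> cosimplex F P2 1 W g -> U = W.
Proof.
move=> p3 [gI cW FE]; apply/eqP; rewrite eqEsubset; apply/andP; split.
  by apply/bigcupsP=> x Px; rewrite (FE x Px).2 subD1set.
have /eqP <- : g @: P2 == W.
  rewrite eqEcard card_in_imset // p3 cW leqnn andbT.
  by apply/subsetP=> _ /imsetP[x /FE[? _] ->].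
apply/subsetP=> _ /imsetP[x Px ->].
(* The vertex [g x] lies on any other side of the triangle. *)
have /set0Pn[x' /setD1P[nx Px']] : P2 :\ x != set0.
  by rewrite -card_gt0; have := cardsD1 x P2; rewrite Px p3; lia.
apply/bigcupP; exists x' => //; rewrite (FE x' Px').2 !inE (FE x Px).1 andbT.
by apply: contraNneq nx => /gI->.
Qed.

Let cU_sun c g : sunflower F P2 1 [set c] g -> #|U| = #|P2|.+1.
Proof.
move=> Fsun; rewrite (UE_sun Fsun) cardsU1; case: Fsun => gI _ FE.
rewrite card_in_imset //; suff -> : c \notin g @: P2 by [].
by apply/imsetP=> -[x /FE[gx _] cE]; rewrite -cE set11 in gx.
Qed.

(** This lets the kernel of the 5-sets keep [U]. Two 5-sets confine [U] to their four common
    elements. A single 5-set contains every column, so there are five columns and three pairs, whose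
    union has four or three elements. *)
Let cU : #|U| <= 4.
Proof.
have [x Px] := set0Pn _ P5n0.
have [/eqP P5_0|/set0Pn[x' /setD1P[nx Px']]] := boolP (P5 :\ x == set0); last first.
  rewrite -(cFI5 Px' Px nx); apply: subset_leq_card.
  by rewrite subsetI !UF5.
have p3 : #|P2| = 3.
  suff : #|Y| = 5.
    by have := cardsD1 x P5; rewrite P5_0 Px cards0; move: cP cY; lia.
  rewrite -(cF5 Px) -cardsT; congr #|pred_of_set _|; apply/setP=> y; rewrite inE.
  have [x' yx'] := F_cover y; have /orP[Px'|Px'] := P25 x'.
    by rewrite (subsetP (F25 Px' Px)).
  have [<-//|nx] := eqVneq x' x.
  by have := in_set0 x'; rewrite -P5_0 !inE nx /=; rewrite inE in Px'; rewrite Px'.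
case: small => [[K [g Fsun]]|[W [g [_ Ftri]]]].
  have [_ /eqP/cards1P[c Kc] _] := Fsun; rewrite Kc in Fsun.
  by rewrite (cU_sun Fsun) p3.
by rewrite (UE_tri p3 Ftri); case: Ftri => _ ->.
Qed.

Let rE x y : r x y = (y \in F x). Proof. by rewrite inE. Qed.

(** The columns are the four elements of [K] and one petal per 5-set, so counting leaves exactly
    three pairs. A star of pairs fills [K] and gives [graph_R]; a triangle misses one element of [K]
    and gives [graph_Q]. *)
Let sun_case (K : {set Y}) (g5 : X -> Y) : U \subset K -> sunflower F P5 4 K g5 ->
  2 < #|X| /\ (isomorphic (bipartite_graph r) (graph_R #|X|)
              \/ isomorphic (bipartite_graph r) (graph_Q #|X|)).
Proof.
move=> UK [g5I cK F5].
have p3 : #|P2| = 3.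
  suff : #|Y| = 4 + #|P5| by move: cP cY; lia.
  rewrite -cK -(card_in_imset g5I) -cardsUI -cardsT.
  have -> : K :&: g5 @: P5 = set0.
    apply/setP=> y; rewrite !inE; apply/negP=> /andP[yK /imsetP[x /F5[+ _] yx]].
    by rewrite -yx yK.
  rewrite cards0 addn0; congr #|pred_of_set _|; apply/esym/setP=> y; rewrite !inE.
  have [x' yx'] := F_cover y; have /orP[Px'|Px'] := P25 x'.
    by rewrite (subsetP UK) //; apply/bigcupP; exists x'.
  move: yx'; rewrite (F5 x' Px').2 => /setU1P[->|->//].
  by rewrite imset_f ?orbT.
have [x3 p5] : 2 < #|X| /\ #|P5| = #|X| - 3 by move: cP; lia.
have [f5 f5I Pf5] := set_ord_enum p5; have [f2 f2I Pf2] := set_ord_enum p3.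
have f52 i j : f5 i <> f2 j by move/esym; apply: P25_neq.
have r5E i y : r (f5 i) y = (y == g5 (f5 i)) || (y \in K).
  by rewrite rE (F5 _ (Pf5 i)).2 !inE.
have g5f5I : injective (g5 \o f5) by move=> i j /g5I/f5I->.
have g5K i : g5 (f5 i) \in K = false by apply/negbTE; have [] := F5 _ (Pf5 i).
have r2K i y : r (f2 i) y -> y \in K.
  by rewrite rE => yF; apply: (subsetP UK); apply/bigcupP; exists (f2 i).
split=> //; case: small => [[K2 [g2 F2sun]]|[W [g2 [_ F2tri]]]]; [left|right].
  have [g2I /eqP/cards1P[c K2c] F2] := F2sun; rewrite {}K2c in F2sun F2.
  have r2E i y : r (f2 i) y = (y == g2 (f2 i)) || (y == c).
    by rewrite rE (F2 _ (Pf2 i)).2 !inE.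
  have g2K i : g2 (f2 i) \in K by apply: (r2K i); rewrite r2E eqxx.
  have cK2 : c \in K by apply: (r2K ord0); rewrite r2E eqxx orbT.
  have g2f2I : injective (g2 \o f2) by move=> i j /g2I/f2I->.
  have g2c i : (g2 (f2 i) == c) = false.
    by have [+ _] := F2 _ (Pf2 i); rewrite inE => /negbTE.
  apply: (isomorphic_block (f1 := f5) (f2 := f2) (g1 := g5 \o f5)
    (g2 := split_fun (g2 \o f2) (fun _ : 'I_1 => c))) => //.
  - split=> //; first apply: split_fun_inj => //.
    + by move=> i j; rewrite !ord1.
    + by move=> i j /eqP; rewrite /= g2c.
    + move=> i j; rewrite /split_fun; case: (split j) => k /= e5.
        by have := g5K i; rewrite e5 g2K.
      by have := g5K i; rewrite e5 cK2.
  - by rewrite subnK.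
  - by rewrite cY; lia.
  - by move=> i j; rewrite r5E id_eq1 g5K orbF (inj_eq g5f5I) eq_sym.
  - move=> i j; rewrite r5E allone_eq1 /split_fun.
    by case: (split j) => k; rewrite ?g2K ?cK2 orbT.
  - by move=> i j; rewrite zero_eq1; apply/negP=> /r2K; rewrite g5K.
  - move=> i j; rewrite r2E id_ones_eq1 /split_fun.
    case: (split j) => k /=; last by rewrite eqxx orbT.
    by rewrite g2c orbF (inj_eq g2f2I) eq_sym.
have UW := UE_tri p3 F2tri; have [g2I cW F2] := F2tri.
have WK : W \subset K by rewrite -UW.
(* [z] lies in every 5-set and in no pair: it is the all-ones column of [id_ones]. *)
have [|z [zW Kz]] := eq_setU1D1 WK; first by rewrite cK cW.
have g2W i : g2 (f2 i) \in W by have [] := F2 _ (Pf2 i).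
have g2K i : g2 (f2 i) \in K by apply: (subsetP WK).
have r2E i y : r (f2 i) y = (y != g2 (f2 i)) && (y \in W).
  by rewrite rE (F2 _ (Pf2 i)).2 !inE.
have g2f2I : injective (g2 \o f2) by move=> i j /g2I/f2I->.
have zK : z \in K by rewrite Kz setU11.
apply: (isomorphic_block (f1 := f5) (f2 := f2)
  (g1 := split_fun (g5 \o f5) (fun _ : 'I_1 => z)) (g2 := g2 \o f2)) => //.
- split=> //; first apply: split_fun_inj => //.
  + by move=> i j; rewrite !ord1.
  + by move=> i j /= e5; have := g5K i; rewrite e5 zK.
  + move=> i j; rewrite /split_fun; case: (split i) => k /= e5.
      by have := g5K k; rewrite e5 g2K.
    by have := g2W j; rewrite -e5 (negPf zW).
- by rewrite subnK.
- by rewrite cY; lia.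
- move=> i j; rewrite r5E id_ones_eq1 /split_fun.
  case: (split j) => k /=; last by rewrite zK orbT.
  by rewrite g5K orbF (inj_eq g5f5I) eq_sym.
- by move=> i j; rewrite r5E allone_eq1 g2K orbT.
- move=> i j; rewrite zero_eq1 r2E /split_fun; apply/negbTE; rewrite negb_and orbC.
  case: (split j) => k /=; last by rewrite zW.
  by rewrite (contraFN (subsetP WK _) (g5K k)).
- by move=> i j; rewrite r2E allone_sub_id_eq1 g2W andbT (inj_eq g2f2I) eq_sym.
Qed.

(** The pairs lie in the 5-sets, so [W] holds all columns, and there are six columns and five rows.
    With at least three 5-sets only one or two pairs remain, too few for a triangle. *)
Let cosimplex_case (W : {set Y}) (g5 : X -> Y) : 2 < #|P5| -> cosimplex F P5 4 W g5 ->
  isomorphic (bipartite_graph r) graph_G3 \/ isomorphic (bipartite_graph r) graph_G4.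
Proof.
move=> q3 [g5I cW F5].
have UW : U \subset W.
  have [x Px] := set0Pn _ P5n0; apply: subset_trans (UF5 Px) _.
  by rewrite (F5 _ Px).2 subD1set.
have inW y : y \in W.
  have [x yx] := F_cover y; have /orP[Px|Px] := P25 x.
    by rewrite (subsetP UW) //; apply/bigcupP; exists x.
  by move: yx; rewrite (F5 x Px).2 => /setD1P[].
have cY6 : #|Y| = 6.
  by rewrite -cW -cardsT; congr #|pred_of_set _|; apply/setP=> y; rewrite inE inW.
have [p_gt0 p2] : 0 < #|P2| /\ #|P2| < 3.
  by rewrite card_gt0 P2n0; move: cP cY; rewrite cY6; lia.
have [c [g2 [g2I _ F2]]] : exists (c : Y) (g2 : X -> Y), sunflower F P2 1 [set c] g2.
  case: small => [[K [g Fsun]]|[? [? []]]]; last by lia.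
  by have [_ /eqP/cards1P[c Kc] _] := Fsun; exists c, g; rewrite -Kc.
have g5F2 x x' : x \in P2 -> x' \in P5 -> g5 x' \notin F x.
  move=> Px Px'; apply/negP=> /(subsetP (F25 Px Px')).
  by rewrite (F5 _ Px').2 setD11.
(* Treats one and two pairs together: the columns omitted by the 5-sets come first, then the leaves
   and the centre of the star of pairs. *)
have enumerations p q (f5 : 'I_q -> X) (f2 : 'I_p -> X) :
    injective f5 -> (forall i, f5 i \in P5) -> injective f2 -> (forall i, f2 i \in P2) ->
    0 < p ->
    [/\ [/\ injective f5, injective f2 & forall i j, f5 i <> f2 j],
        [/\ injective (g5 \o f5), injective (split_fun (g2 \o f2) (fun _ : 'I_1 => c))
           & forall i j, (g5 \o f5) i <> split_fun (g2 \o f2) (fun _ : 'I_1 => c) j],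
        forall i j, r (f5 i) (g5 (f5 j)) = (i != j),
        forall i j, r (f5 i) (split_fun (g2 \o f2) (fun _ : 'I_1 => c) j)
      & [/\ forall i j, r (f2 i) (g5 (f5 j)) = false
          & forall i j, r (f2 i) (split_fun (g2 \o f2) (fun _ : 'I_1 => c) j)
              = if split j is inl k then i == k else true]].
  move=> f5I Pf5 f2I Pf2 p0; pose i0 := Ordinal p0.
  have r2E i y : r (f2 i) y = (y == g2 (f2 i)) || (y == c).
    by rewrite rE (F2 _ (Pf2 i)).2 !inE.
  have r2g i j : r (f2 i) (g5 (f5 j)) = false.
    by rewrite rE; apply/negbTE/g5F2.
  (* Each column of the second block lies in a pair, hence in every 5-set, and so differs from the
     omitted columns. *)
  have r2s j : exists i, r (f2 i) (split_fun (g2 \o f2) (fun _ : 'I_1 => c) j).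
    rewrite /split_fun; case: (split j) => k; last by exists i0; rewrite r2E eqxx orbT.
    by exists k; rewrite r2E eqxx.
  have g5f5I : injective (g5 \o f5) by move=> i j /g5I/f5I->.
  have g2f2I : injective (g2 \o f2) by move=> i j /g2I/f2I->.
  have g2c i : (g2 (f2 i) == c) = false.
    by have [+ _] := F2 _ (Pf2 i); rewrite inE => /negbTE.
  split.
  - by split=> // i j /esym; apply: P25_neq.
  - split=> //.
      apply: split_fun_inj => //; first by move=> i j; rewrite !ord1.
      by move=> i j /eqP; rewrite /= g2c.
    by move=> i j /= e; have [k] := r2s j; rewrite -e r2g.
  - by move=> i j; rewrite rE (F5 _ (Pf5 i)).2 !inE inW andbT (inj_eq g5f5I) eq_sym.
  - move=> i j; rewrite rE; have [k] := r2s j; rewrite rE; apply: subsetP.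
    exact: F25.
  - split=> // i j; rewrite r2E /split_fun; case: (split j) => k /=.
      by rewrite g2c orbF (inj_eq g2f2I) eq_sym.
    by rewrite eqxx orbT.
have [[p1 q4]|[p2' q3']] : (#|P2| = 1 /\ #|P5| = 4) \/ (#|P2| = 2 /\ #|P5| = 3).
  by move: cP cY; rewrite cY6; lia.
  left; have [f5 f5I Pf5] := set_ord_enum q4; have [f2 f2I Pf2] := set_ord_enum p1.
  have [//|fI gI r55 r52 [r25 r22]] := enumerations _ _ _ _ f5I Pf5 f2I Pf2.
  apply: (isomorphic_block fI gI); rewrite ?cY6 //.
  - by move: cY; rewrite cY6; lia.
  - by move=> i j; rewrite r55 allone_sub_id_eq1.
  - by move=> i j; rewrite allone_eq1 r52.
  - by move=> i j; rewrite zero_eq1 r25.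
  (* With a single pair the identity part is the entry 1, so the block is all ones. *)
  - by move=> i j; rewrite allone_eq1 r22; case: (split j) => // k; rewrite !ord1.
right; have [f5 f5I Pf5] := set_ord_enum q3'; have [f2 f2I Pf2] := set_ord_enum p2'.
have [//|fI gI r55 r52 [r25 r22]] := enumerations _ _ _ _ f5I Pf5 f2I Pf2.
apply: (isomorphic_block fI gI); rewrite ?cY6 //.
- by move: cY; rewrite cY6; lia.
- by move=> i j; rewrite r55 allone_sub_id_eq1.
- by move=> i j; rewrite allone_eq1 r52.
- by move=> i j; rewrite zero_eq1 r25.
- by move=> i j; rewrite id_ones_eq1 r22.
Qed.

Lemma mixed_degrees :
  [\/ 2 < #|X| /\ (isomorphic (bipartite_graph r) (graph_R #|X|)
                  \/ isomorphic (bipartite_graph r) (graph_Q #|X|)),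
      isomorphic (bipartite_graph r) graph_G3
    | isomorphic (bipartite_graph r) graph_G4].
Proof.
have [[K [g [UK /(sun_case UK)]]]|[W [g [P3 /(cosimplex_case P3)[]]]]] :=
  near_family P5n0 cU cF5 UF5 cFI5.
- by constructor 1.
- by constructor 2.
- by constructor 3.
Qed.

End Mixed.

(** * Comparison of degrees and the final case analysis *)

Lemma degrees_lt (X Y : finType) (F : X -> {set Y}) x x' :
  1 < #|F x| -> near_orthogonal F -> #|F x| < #|F x'| -> #|F x| = 2 /\ #|F x'| = 5.
Proof.
move=> Fx_gt1 F_no lt; have /F_no : x != x' by apply: contraTneq lt => ->; rewrite ltnn.
have := subset_leq_card (subsetIl (F x) (F x')); move: Fx_gt1.
move: lt; set a := #|F x|; set b := #|F x'|; set m := #|_ :&: _|.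
move=> ab a1 ma mE.
(* Since [b - 1 >= a], [m ^ 2] is at least [(a - 1) * a], which exceeds [(a - 1) ^ 2]. *)
have m_a : m = a by apply/eqP; rewrite eqn_leq ma /=; nia.
(* Subtract [(a - 1) * (a + 1) = a ^ 2 - 1] from [(a - 1) * (b - 1) = a ^ 2]; both factors are then
   1. *)
have /eqP : (a - 1) * (b - 1 - a.+1) = 1 by rewrite mulnBr -mE m_a; nia.
rewrite muln_eq1; lia.
Qed.

Section Degrees.
Variables (X Y : finType) (r : X -> Y -> bool).
Let F := nbr r.
Hypotheses (F_gt1 : forall x, 1 < #|F x|) (F_no : near_orthogonal F).
Hypotheses (F_cover : forall y, exists x, y \in F x) (cY : #|Y| = #|X|.+1).

(** In a sunflower the columns are the kernel and one petal per row, so counting forces a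
    one-element kernel, as in [graph_S]. In a cosimplex each row omits one column, and the one
    column omitted by no row is the added vertex of [graph_H]. *)
Lemma equal_degrees (x0 : X) :
  (forall x, #|F x| = #|F x0|) ->
  isomorphic (bipartite_graph r) (graph_S #|X|)
  \/ isomorphic (bipartite_graph r) (graph_H #|X|).
Proof.
have [d dE] : exists d, #|F x0| = d.+2 by exists (#|F x0| - 2); have := F_gt1 x0; lia.
rewrite dE => Fd.
have FI x x' : x \in [set: X] -> x' \in [set: X] -> x != x' -> #|F x :&: F x'| = d.+1.
  by move=> _ _ /F_no/eqP; rewrite !Fd subn1 /= mulnn eqn_exp2r // => /eqP.
have [|||[K [g [_ [gI cK FE]]]]|[W [g [_ [gI cW FE]]]]] :=
  near_family (P := [set: X]) (U := set0) _ _ (fun x _ => Fd x) _ FI.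
- by apply/set0Pn; exists x0; rewrite inE.
- by rewrite cards0.
- by move=> x _; apply: sub0set.
- left; have {}gI : injective g by move=> x x'; apply: gI; rewrite inE.
  have {}FE x : g x \notin K /\ F x = g x |: K by apply: FE; rewrite inE.
  have d0 : d = 0.
    suff : #|Y| = d.+1 + #|X| by rewrite cY; lia.
    rewrite -cK -[#|X|]cardsT -(card_imset _ gI) -cardsUI -[LHS]cardsT.
    have -> : K :&: g @: [set: X] = set0.
      apply/setP=> y; rewrite !inE; apply/negP=> /andP[yK /imsetP[x _ yx]].
      by have [+ _] := FE x; rewrite -yx yK.
    rewrite cards0 addn0; congr #|pred_of_set _|; apply/esym/setP=> y; rewrite !inE.
    have [x yx] := F_cover y; move: yx; rewrite (FE x).2 => /setU1P[->|->//].
    by rewrite imset_f ?orbT.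
  move: cK; rewrite d0 => /eqP/cards1P[c Kc].
  apply: (isomorphic_S (c := c) gI) => // [x|x y].
    by have [+ _] := FE x; rewrite Kc inE.
  by have := FE x; rewrite Kc => -[_ /setP/(_ y)]; rewrite !inE orbC.
right; have {}gI : injective g by move=> x x'; apply: gI; rewrite inE.
have {}FE x : g x \in W /\ F x = W :\ g x by apply: FE; rewrite inE.
have WT y : y \in W.
  by have [x] := F_cover y; rewrite (FE x).2 => /setD1P[].
have [c gc] : exists c, forall x, g x != c.
  have /subsetPn[c _ cg] : ~~ ([set: Y] \subset codom g).
    apply/negP=> /subset_leq_card; rewrite cardsT card_codom // cY; lia.
  by exists c => x; apply: contraNneq cg => <-; apply: codom_f.
apply: (isomorphic_H gI gc) => // x y.
by have [_ /setP/(_ y)] := FE x; rewrite !inE WT andbT.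
Qed.

End Degrees.

Lemma near_orthogonal_classification (X Y : finType) (r : X -> Y -> bool) :
  0 < #|X| -> #|Y| = #|X|.+1 -> (forall x, 1 < #|nbr r x|) ->
  near_orthogonal (nbr r) -> (forall y, exists x, y \in nbr r x) ->
  let B := bipartite_graph r in
  [\/ isomorphic B (graph_S #|X|),
      (2 < #|X|)%N /\ (isomorphic B (graph_R #|X|) \/ isomorphic B (graph_Q #|X|)),
      isomorphic B (graph_H #|X|)
    | isomorphic B graph_G3 \/ isomorphic B graph_G4].
Proof.
move=> /card_gt0P[x0 _] cY F_gt1 F_no F_cover B.
have [/forallP eqF|/forallPn[x1 neqF]] := boolP [forall x, #|nbr r x| == #|nbr r x0|].
  have [x||] := equal_degrees F_gt1 F_no F_cover cY (x0 := x0); first exact/eqP.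
    by constructor 1.
  by constructor 3.
have lt x := degrees_lt (F_gt1 x) F_no.
have [x2 [x5 [c2 c5]]] : exists x2 x5, #|nbr r x2| = 2 /\ #|nbr r x5| = 5.
  rewrite neq_ltn in neqF; have /orP[/lt c|/lt c] := neqF.
    by exists x1, x0.
  by exists x0, x1.
have [x|||||] := mixed_degrees (r := r) _ _ _ F_no F_cover cY.
(* A degree other than 2 exceeds that of [x2], hence is 5 by [lt]. *)
- rewrite !inE; have [//|n2] := eqVneq; apply/eqP.
  have /lt[] : #|nbr r x2| < #|nbr r x| by have := F_gt1 x; rewrite c2; lia.
  by [].
- by apply/set0Pn; exists x2; rewrite inE c2.
- by apply/set0Pn; exists x5; rewrite inE c5.
- by constructor 2.
- by constructor 4; left.
- by constructor 4; right.
Qed.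

Local Open Scope ring_scope.

Theorem theorem10 (n : nat) (G : sgraph)
  (n_odd : odd n) (n_ge3 : (3 <= n)%N)
  (G_conn : connected G) (G_order : #|G| = n)
  (G_spec : msubset (0 :: nseq ((n - 3)./2) 1 ++ nseq ((n - 3)./2) (- 1))
                    (spectrum G)) :
  let k := (n - 1)./2 in
  [\/ isomorphic G (graph_S k),
      (3 <= k)%N /\ (isomorphic G (graph_R k) \/ isomorphic G (graph_Q k)),
      isomorphic G (graph_H k)
    | isomorphic G graph_G3 \/ isomorphic G graph_G4].
Proof.
move=> k; have cG : #|G| = (2 * (n - 3)./2 + 3)%N by lia.
have [X [Y [r [/isomorphic_sym iso [cX cY] F_gt1 F_no F_cover]]]] :=
  near_orthogonal_bipartition G_conn cG G_spec.
(* The number of rows is [(n - 3)./2 + 1], which is [(n - 1)./2]. *)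
have kX : k = #|X| by rewrite cX /k; lia.
have tr H := isomorphic_trans (K := H) iso; rewrite kX.
have [||/tr|[k3 [/tr|/tr]]|/tr|[/tr|/tr]] :=
  near_orthogonal_classification _ _ F_gt1 F_no F_cover.
- by rewrite cX.
- by rewrite cX.
- by constructor 1.
- by constructor 2; split=> //; left.
- by constructor 2; split=> //; right.
- by constructor 3.
- by constructor 4; left.
- by constructor 4; right.
Qed.
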